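(* Let $(\Sigma,F)$ be an oriented Finsler surface (a 2-dimensional manifold with a Finsler metric), let $f\colon\Sigma\to\mathbb{R}$ be a $C^\infty$ function and let $F_f=e^fF$. Then $$\Delta^{F_f}=e^{-2f}\Delta^F .$$
   Context: For a Finsler metric $F$ on an oriented $n$-manifold $M$ (continuous $F\colon TM\to[0,\infty)$, smooth off the zero section, positively homogeneous of degree one, positive-definite, strongly convex): $HM:=(TM\smallsetminus\{\text{zero section}\})/\mathbb{R}^+$, with quotient map $r\colon TM\smallsetminus 0\to HM$, projection $\pi\colon HM\to M$, fibers $H_xM$, vertical bundle $VHM=\ker d\pi$. The Hilbert form is the contact 1-form $A$ on $HM$ with $r^*A=\frac{\partial F}{\partial v^i}dx^i$; its Reeb field $X$ satisfies $A(X)=1$, $i_XdA=0$. $HM$ is oriented by $A\wedge dA^{n-1}$ and the fibers $H_xM$ so that fiber orientation followed by base orientation is that of $HM$. There is a unique volume form $\Omega^F$ on $M$ for which there is an $(n-1)$-form $\alpha^F$ on $HM$, nowhere zero on $VHM$ (and uniquely determined there), with $\alpha^F\wedge\pi^*\Omega^F=A\wedge dA^{n-1}$ and $\int_{H_xM}\alpha^F=\mathrm{vol}_{\mathrm{Eucl}}(\mathbb{S}^{n-1})$ for all $x$. The Finsler--Laplace operator is $\Delta^Fu(x)=\frac{n}{\mathrm{vol}_{\mathrm{Eucl}}(\mathbb{S}^{n-1})}\int_{H_xM}L_X^2(\pi^*u)\,\alpha^F$. Here $n=2$ and $M=\Sigma$. $F_f$ is the function $(x,v)\mapsto e^{f(x)}F(x,v)$.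 *)

(* Defs.v *)
From HB Require Import structures.
From mathcomp Require Import all_boot all_order all_algebra.
From mathcomp Require Import all_classical all_reals all_analysis.
Set Implicit Arguments.
Unset Strict Implicit.
Unset Printing Implicit Defensive.
Import Order.TTheory GRing.Theory Num.Theory.
Import numFieldNormedType.Exports.
Local Open Scope classical_set_scope.
Local Open Scope ring_scope.

(* C^k on an open subset D of a finite-dimensional space. *)
Fixpoint Ck (R : realType) (V W : normedModType R) (k : nat) (D : set V)
    (g : V -> W) : Prop :=
  if k is k'.+1 then
    (forall x, D x -> differentiable g x) /\
    (forall v : V, Ck k' D ('D_v g))
  else forall x, D x -> {for x, continuous g}.

Definition smooth_on (R : realType) (V W : normedModType R) (D : set V)
    (g : V -> W) : Prop := forall k, Ck k D g.

(* An atlas on T modelled on E is given by parametrizations E -> T rather than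
   by their inverses.  They need only be local diffeomorphisms onto their
   images: the atlas of the circle bundle HM below uses an angle modulo 2 pi.
   (idx is pointed only so that a chart can be chosen around each point.) *)
Record atlas (R : realType) (T : Type) (E : normedModType R) := Atlas {
  idx : pointedType;
  dom : idx -> set E;
  par : idx -> E -> T }.
Arguments dom {R T E} a i.
Arguments par {R T E} a i x.

(* s is a smooth change of coordinates from c to d near x. *)
Definition coord_change (R : realType) (T : Type) (E : normedModType R)
    (S : atlas T E) (c d : idx S) (x : E) (s : E -> E) : Prop :=
  exists2 D : set E, open_nbhs x D &
    smooth_on D s /\
    forall z, D z -> [/\ dom S c z, dom S d (s z) & par S d (s z) = par S c z].

Definition oriented_surface (R : realType) (T : topologicalType)
    (S : atlas T 'rV[R]_2) : Prop :=
  [/\ hausdorff_space T, @second_countable T,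
      forall p : T, exists i x, dom S i x /\ par S i x = p,
      forall i, [/\ open (dom S i), {in dom S i &, injective (par S i)},
        (forall x, dom S i x -> {for x, continuous (par S i)}) &
        (forall U, open U -> U `<=` dom S i -> open (par S i @` U))] &
      forall c d x y, dom S c x -> dom S d y -> par S c x = par S d y ->
        exists s, [/\ coord_change c d x s, s x = y & 0 < \det ('J s x)]].

Definition Ck_fun (R : realType) (T : Type) (E : normedModType R)
    (S : atlas T E) (k : nat) (u : T -> R) : Prop :=
  forall i, Ck k (dom S i) (u \o par S i).

Definition smooth_fun (R : realType) (T : Type) (E : normedModType R)
    (S : atlas T E) (u : T -> R) : Prop := forall k, Ck_fun S k u.

(* All coordinate expressions of the tangent vector which in the chart c has
   base point x and components v. *)
Definition coord_class (R : realType) (T : Type) (E : normedModType R)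
    (S : atlas T E) (c : idx S) (x v : E) : set (idx S * (E * E)) :=
  [set t | exists s, [/\ coord_change c t.1 x s, s x = t.2.1
                       & 'D_v s x = t.2.2]].

(* The tangent bundle.  Besides the tangent vectors, the type contains the
   values of tvec c x v for x outside the domain of c, which are not used. *)
Record tangent (R : realType) (T : Type) (E : normedModType R)
    (S : atlas T E) := Tangent {
  tbase : T;
  treps : set (idx S * (E * E));
  _ : exists c x v, tbase = par S c x /\ treps = coord_class c x v }.

Definition tvec (R : realType) (T : Type) (E : normedModType R)
    (S : atlas T E) (c : idx S) (x v : E) : tangent S :=
  @Tangent R T E S (par S c x) (coord_class c x v)
    (ex_intro _ c (ex_intro _ x (ex_intro _ v (conj erefl erefl)))).

Definition one_form (R : realType) (T : Type) (E : normedModType R)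
    (S : atlas T E) (a : tangent S -> R) : Prop :=
  forall c, (forall x, dom S c x -> scalar (fun v => a (tvec c x v))) /\
    (forall v, smooth_on (dom S c) (fun x => a (tvec c x v))).

(* A 2-form; its values at vectors with different base points are not used. *)
Definition two_form (R : realType) (T : Type) (E : normedModType R)
    (S : atlas T E) (b : tangent S -> tangent S -> R) : Prop :=
  forall c,
    (forall x v, dom S c x ->
      scalar (fun w => b (tvec c x v) (tvec c x w)) /\
      scalar (fun w => b (tvec c x w) (tvec c x v))) /\
    (forall x v, dom S c x -> b (tvec c x v) (tvec c x v) = 0) /\
    (forall v w, smooth_on (dom S c) (fun x => b (tvec c x v) (tvec c x w))).

Definition volume_form (R : realType) (T : Type) (S : atlas T 'rV[R]_2)
    (b : tangent S -> tangent S -> R) : Prop :=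
  two_form b /\
  forall c x, dom S c x -> exists v w, b (tvec c x v) (tvec c x w) != 0.

(* The exterior derivative, in coordinates, of a 1-form on an open subset of E:
   a x v is the value at the point x of the form on the vector v. *)
Definition ext_d (R : realType) (E : normedModType R) (a : E -> E -> R)
    (x v w : E) : R :=
  'D_v (fun z => a z w) x - 'D_w (fun z => a z v) x.

Definition wedge12 (R : realType) (E : normedModType R) (a : E -> R)
    (b : E -> E -> R) (u v w : E) : R :=
  a u * b v w - a v * b u w + a w * b u v.

Definition finsler (R : realType) (T : Type) (S : atlas T 'rV[R]_2)
    (F : tangent S -> R) : Prop :=
  forall i : idx S,
  [/\ forall z : 'rV[R]_2 * 'rV[R]_2, dom S i z.1 ->
        {for z, continuous (fun z => F (tvec i z.1 z.2))},
      smooth_on [set z : 'rV[R]_2 * 'rV[R]_2 | dom S i z.1 /\ z.2 != 0]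
        (fun z => F (tvec i z.1 z.2)),
      forall x v (l : R), dom S i x -> 0 < l ->
        F (tvec i x (l *: v)) = l * F (tvec i x v),
      forall x v, dom S i x ->
        0 <= F (tvec i x v) /\ (F (tvec i x v) = 0 <-> v = 0) &
      forall x v w, dom S i x -> v != 0 -> w != 0 ->
        0 < 'D_w ('D_w (fun v' => F (tvec i x v') ^+ 2)) v].

Definition conformal (R : realType) (T : Type) (E : normedModType R)
    (S : atlas T E) (f : T -> R) (F : tangent S -> R) : tangent S -> R :=
  fun t => expR (f (tbase t)) * F t.

Section homogenized_bundle.
Context (R : realType) (T : Type) (S : atlas T 'rV[R]_2).

Definition dir (t : R) : 'rV[R]_2 := \row_j (if j == ord0 then cos t else sin t).

(* The image in HM of the vector with components v at the point of
   coordinates x, as a half-line in a tangent space. *)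
Definition ray (i : idx S) (x v : 'rV[R]_2) : set (tangent S) :=
  [set t | exists2 l : R, 0 < l & t = tvec i x (l *: v)].

(* HM, with coordinates (x, t) for the ray directed by (cos t, sin t) in the
   tangent space at x; the projection pi to the surface is (x, t) |-> x. *)
Definition HM : atlas (set (tangent S)) ('rV[R]_2 * R)%type :=
  @Atlas R (set (tangent S)) ('rV[R]_2 * R)%type (idx S)
    (fun i => [set y | dom S i y.1]) (fun i y => ray i y.1 (dir y.2)).

Definition HMvec (i : idx S) (y xi : 'rV[R]_2 * R) : tangent HM :=
  @tvec R _ _ HM i y xi.

Definition d_theta : 'rV[R]_2 * R := (0, 1).
Definition d_x (j : 'I_2) : 'rV[R]_2 * R := (delta_mx ord0 j, 0).

(* In the chart i, with v = dir t: dF/dv^j dx^j evaluated on xi. *)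
Definition hilbert_form (F : tangent S -> R) (i : idx S)
    (y xi : 'rV[R]_2 * R) : R :=
  'D_(xi.1) (fun v => F (tvec i y.1 v)) (dir y.2).

Definition contact_volume (F : tangent S -> R) (i : idx S)
    (y : 'rV[R]_2 * R) : ('rV[R]_2 * R) -> ('rV[R]_2 * R) ->
    ('rV[R]_2 * R) -> R :=
  wedge12 (hilbert_form F i y) (ext_d (hilbert_form F i) y).

(* The components in the chart i of the Reeb field. *)
Definition reeb (F : tangent S -> R) (i : idx S) (y : 'rV[R]_2 * R) :
    'rV[R]_2 * R :=
  get [set xi : 'rV[R]_2 * R | hilbert_form F i y xi = 1 /\
    forall eta, ext_d (hilbert_form F i) y xi eta = 0].

(* The orientation of d/dt in the fiber: +1 iff (d/dt, d/dx^1, d/dx^2) is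
   positive for A /\ dA, (d/dx^1, d/dx^2) being positive on the surface. *)
Definition fiber_sign (F : tangent S -> R) (i : idx S)
    (y : 'rV[R]_2 * R) : R :=
  Num.sg (contact_volume F i y d_theta (d_x ord0) (d_x ord_max)).

(* The integral of g a over the fiber of HM (oriented by F) at the point of
   coordinates x, for a function g given in the chart i. *)
Definition fiber_integral (F : tangent S -> R) (a : tangent HM -> R)
    (i : idx S) (x : 'rV[R]_2) (g : 'rV[R]_2 * R -> R) : R :=
  \int[@lebesgue_measure R]_(t in `[0, 2 * pi])
    (fiber_sign F i (x, t) * (g (x, t) * a (HMvec i (x, t) d_theta))).

Definition vol_circle : R := 2 * pi.

Definition finsler_volume_angle (F : tangent S -> R)
    (Om : tangent S -> tangent S -> R) (a : tangent HM -> R) : Prop :=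
  [/\ volume_form Om, one_form a,
      forall (i : idx S) y xi, dom HM i y -> xi.1 = 0 -> xi != 0 ->
        a (HMvec i y xi) != 0,
      forall (i : idx S) y u v w, dom HM i y ->
        wedge12 (fun xi => a (HMvec i y xi))
          (fun xi eta => Om (tvec i y.1 xi.1) (tvec i y.1 eta.1)) u v w
        = contact_volume F i y u v w &
      forall i x, dom S i x -> fiber_integral F a i x (fun=> 1) = vol_circle].

Definition volume_angle (F : tangent S -> R) :
    (tangent S -> tangent S -> R) * (tangent HM -> R) :=
  get [set Oa | finsler_volume_angle F Oa.1 Oa.2].

(* Omega^F and alpha^F; only the restriction of the latter to the fibers is
   determined by F. *)
Definition finsler_volume (F : tangent S -> R) := (volume_angle F).1.
Definition angle_form (F : tangent S -> R) := (volume_angle F).2.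

Definition lie_reeb (F : tangent S -> R) (i : idx S)
    (w : 'rV[R]_2 * R -> R) : 'rV[R]_2 * R -> R :=
  fun y => 'D_(reeb F i y) w y.

Definition coords_at (p : T) : idx S * 'rV[R]_2 :=
  get [set c | dom S c.1 c.2 /\ par S c.1 c.2 = p].

Definition finsler_laplacian_in (F : tangent S -> R) (u : T -> R)
    (i : idx S) (x : 'rV[R]_2) : R :=
  2%:R / vol_circle *
    fiber_integral F (angle_form F) i x
      (lie_reeb F i (lie_reeb F i (fun y => u (par S i y.1)))).

(* All the objects above transform as tensors, so that the value does not
   depend on the chart chosen around p. *)
Definition finsler_laplacian (F : tangent S -> R) (u : T -> R) (p : T) : R :=
  finsler_laplacian_in F u (coords_at p).1 (coords_at p).2.

End homogenized_bundle.

(* Main.v *)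
From HB Require Import structures.
Require Import Defs.
From mathcomp Require Import all_boot all_order all_algebra.
From mathcomp Require Import all_classical all_reals all_analysis.
From mathcomp Require Import ring.
Import Order.TTheory GRing.Theory Num.Theory.
Import numFieldNormedType.Exports.
Set Implicit Arguments.
Unset Strict Implicit.
Unset Printing Implicit Defensive.
Local Open Scope classical_set_scope.
Local Open Scope ring_scope.

(** In a chart let (x, t) stand for the half-line directed by dir t over x, write
    A = a0 dx^0 + a1 dx^1 for the Hilbert form of F, and let a prime denote d/dt.
    As A has no dt component, A /\ dA = P dt /\ dx^0 /\ dx^1 with
    P = a1 a0' - a0 a1', and the Reeb equations, which are linear, give
      X = q + (kappa / P) d/dt,  q = (- a1', a0') / P,  kappa = d_0 a1 - d_1 a0
    ([wedge_formE], [reeb_formE]).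

    Passing from F to e^f F replaces A by e^f A.  With f_j = d_j f this turns P
    into e^{2f} P and X into e^{-f} (X + zeta d/dt), where
    zeta = (f_0 a1 - f_1 a0) / P: apart from the factor e^{-f}, only the vertical
    component changes.

    Since A /\ dA is multiplied by a function on the base, (e^{2f} Omega, alpha)
    is a volume form and angle form for e^f F as soon as (Omega, alpha) is one
    for F, and conversely ([volume_angle_conformal], [volume_angle_conformalV]).
    The normalization over the fibres determines alpha on vertical vectors
    ([angle_unique]), so F and e^f F have the same angle form there.  These pairs
    are selected by choice; they exist for F exactly when they exist for e^f F,
    and otherwise the selected angle form is 0 in both cases.

    It remains to compare second derivatives.  For a function u on the base,
      e^{2f} X_f^2 u - X^2 u = zeta (Xu)' - (Xf)(Xu).
    On the fibre, alpha is P dt divided by Omega(e_0, e_1), which is constant in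
    t; and multiplying the right-hand side by P gives
      (f_0 a1 - f_1 a0) (Xu)' - P (Xf)(Xu) = d/dt ((Xu) (f_0 a1 - f_1 a0)),
    because P q = (- a1', a0').  This is the derivative of a function on a closed
    curve, so that its integral vanishes ([fiber_integral_conformal]). *)

(** * Functions of class C^k *)

Section Ck_calculus.
Context (R : realType) (V : normedModType R).
Implicit Types (D : set V) (g h : V -> R).

Lemma near_open D x : open D -> D x -> \forall z \near x, D z.
Proof. by move=> oD Dx; apply: open_nbhs_nbhs. Qed.

(** Derivatives are local, so identities that hold only on the domain of a chart
    may be differentiated there. *)
Lemma eq_derive_open (W : normedModType R) D (g h : V -> W) x v :
  open D -> {in D, g =1 h} -> D x -> 'D_v g x = 'D_v h x.
Proof.
move=> oD gh Dx; have [->|v0] := eqVneq v 0; first by rewrite !derive0.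
apply: near_eq_derive => //.
by apply: filterS (near_open oD Dx) => z Dz; apply: gh; rewrite inE.
Qed.

(** The difference of the two functions vanishes near x, hence has differential 0
    there. *)
Lemma eq_differentiable_open D g h x :
  open D -> {in D, g =1 h} -> D x -> differentiable g x -> differentiable h x.
Proof.
move=> oD gh Dx dg.
have zc : continuous (\0 : V -> R) by move=> y; apply: cvg_cst.
have eE : (h - g) \o shift x = cst ((h - g) x) + (\0 : {linear V -> R}) +o_ 0 id.
  apply/eqaddoP => _/posnumP[e].
  have : \forall y \near (0 : V), D (y + x).
    have := near_open oD Dx; rewrite (near_shift 0) subr0.
    by apply: filterS => y /=.
  apply: filterS => y Dyx /=.
  have hg z : D z -> h z - g z = 0 by move=> Dz; rewrite gh ?inE// subrr.
  rewrite !fctE /= !hg// addr0 subr0 normr0.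
  exact: mulr_ge0.
have dE := diff_unique zc eE.
have de : differentiable (h - g) x.
  by apply/diff_locallyP; rewrite dE; split.
have -> : h = g + (h - g) by apply/funext => y; rewrite !fctE addrC subrK.
exact: differentiableD.
Qed.

Lemma Ck_continuous k D g : Ck k D g -> forall x, D x -> {for x, continuous g}.
Proof. by case: k => [//|k] [dg _] x Dx; exact/differentiable_continuous/dg. Qed.

Lemma Ck0 k D g : Ck k D g -> Ck 0 D g.
Proof. exact: Ck_continuous. Qed.

Lemma CkS k D g : Ck k.+1 D g -> Ck k D g.
Proof.
elim: k g => [|k IH] g; first exact: Ck0.
by case=> dg Dg; split => // v; exact/IH/Dg.
Qed.

Lemma eq_Ck k D g h : open D -> {in D, g =1 h} -> Ck k D g -> Ck k D h.
Proof.
move=> oD; elim: k g h => [|k IH] g h gh.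
  move=> cg x Dx; have ghx : g x = h x by apply: gh; rewrite inE.
  rewrite /prop_for /continuous_at -ghx.
  apply: cvg_trans (cg x Dx); apply: near_eq_cvg.
  by apply: filterS (near_open oD Dx) => y Dy; apply: gh; rewrite inE.
case=> dg Dg; split=> [x Dx|v].
  exact: (eq_differentiable_open oD gh Dx (dg x Dx)).
apply: IH (Dg v) => x; rewrite inE => Dx; exact: (eq_derive_open _ oD gh).
Qed.

Lemma Ck_differentiable k D g : Ck k.+1 D g -> forall x, D x -> differentiable g x.
Proof. by case. Qed.

Lemma Ck_cst k D (c : R) : Ck k D (cst c : V -> R).
Proof.
elim: k c => [|k IH] c; first by move=> x _; apply: cvg_cst.
split=> [x _|v]; first exact: differentiable_cst.
rewrite (_ : 'D_v (cst c) = cst 0) //.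
by apply/funext => x; rewrite derive_cst.
Qed.

Lemma CkD k D g h : open D -> Ck k D g -> Ck k D h -> Ck k D (g + h).
Proof.
move=> oD; elim: k g h => [|k IH] g h.
  by move=> cg ch x Dx; apply: cvgD; [exact: cg|exact: ch].
case=> dg Dg [dh Dh]; split=> [x Dx|v].
  by apply: differentiableD; [exact: dg|exact: dh].
apply: eq_Ck (IH _ _ (Dg v) (Dh v)) => // x; rewrite inE => Dx.
by rewrite deriveD//; apply/diff_derivable; [exact: dg|exact: dh].
Qed.

(** Leibniz' rule: each factor of the derivative is again of class C^k. *)
Lemma CkM k D g h : open D -> Ck k D g -> Ck k D h -> Ck k D (g * h).
Proof.
move=> oD; elim: k g h => [|k IH] g h.
  by move=> cg ch x Dx; apply: cvgM; [exact: cg|exact: ch].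
move=> Cg Ch; have [dg Dg] := Cg; have [dh Dh] := Ch; split=> [x Dx|v].
  by apply: differentiableM; [exact: dg|exact: dh].
have := CkD oD (IH _ _ (CkS Cg) (Dh v)) (IH _ _ (CkS Ch) (Dg v)).
apply: eq_Ck => // x; rewrite inE => Dx.
by rewrite deriveM//; apply/diff_derivable; [exact: dg|exact: dh].
Qed.

Lemma CkN k D g : open D -> Ck k D g -> Ck k D (- g).
Proof.
move=> oD Cg; have := CkM oD (Ck_cst k D (-1)) Cg; apply: eq_Ck => // x _.
by rewrite !fctE mulN1r.
Qed.

Lemma derive_comp_R (phi : R -> R) g x v : differentiable g x ->
  differentiable phi (g x) -> 'D_v (phi \o g) x = 'D_1 phi (g x) * 'D_v g x.
Proof.
move=> dg dphi; rewrite !deriveE//; last exact: differentiable_comp.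
rewrite diff_comp//= -[X in 'd phi (g x) X]mulr1.
by rewrite [LHS]linearZ mulrC.
Qed.

Lemma differentiable_expR (t : R) : differentiable (expR : R -> R) t.
Proof. exact/derivable1_diffP/derivable_expR. Qed.

Lemma derive_expR_comp g x v : differentiable g x ->
  'D_v (expR \o g) x = expR (g x) * 'D_v g x.
Proof.
move=> dg; rewrite derive_comp_R//; last exact: differentiable_expR.
by congr (_ * _); exact: (congr1 (@^~ (g x)) (@derive_expR R)).
Qed.

Lemma Ck_expR k D g : open D -> Ck k D g -> Ck k D (expR \o g).
Proof.
move=> oD; elim: k => [|k IH] Cg.
  by move=> x Dx; apply: continuous_comp; [exact: Cg|exact: continuous_expR].
have [dg Dg] := Cg; split=> [x Dx|v].
  by apply: differentiable_comp; [exact: dg|exact: differentiable_expR].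
have := CkM oD (IH (CkS Cg)) (Dg v); apply: eq_Ck => // x; rewrite inE => Dx.
by rewrite derive_expR_comp//; exact: dg.
Qed.

Lemma CkV k D g : open D -> (forall x, D x -> g x != 0) ->
  Ck k D g -> Ck k D (fun x => (g x)^-1).
Proof.
move=> oD g0; elim: k => [|k IH] Cg.
  by move=> x Dx; apply: cvgV; [exact: g0|exact: Cg].
have [dg Dg] := Cg; split=> [x Dx|v].
  by apply: differentiableV; [exact: dg|exact: g0].
have Cg' := IH (CkS Cg).
have := CkN oD (CkM oD (CkM oD Cg' Cg') (Dg v)).
apply: eq_Ck => // x; rewrite inE => Dx.
rewrite deriveV ?g0//; last exact/diff_derivable/dg.
by rewrite !fctE -exprVn expr2 -mulNr.
Qed.

Lemma Ck_derive k D g v : Ck k.+1 D g -> Ck k D ('D_v g).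
Proof. by case=> _ /(_ v). Qed.

End Ck_calculus.

(** * Fibre coordinates and the polar substitution *)

Section polar.
Context (R : realType).
Notation V2 := 'rV[R]_2.
Notation E3 := (V2 * R)%type.

Definition ej (j : 'I_2) : V2 := delta_mx ord0 j.

Lemma ord2_cases (j : 'I_2) : j = ord0 \/ j = ord_max.
Proof. by case: j => [[|[|//]] i]; [left|right]; apply/val_inj. Qed.

Lemma row2E (v : V2) : v = v ord0 ord0 *: ej ord0 + v ord0 ord_max *: ej ord_max.
Proof.
by apply/rowP => j; rewrite !mxE; case: (ord2_cases j) => ->;
  rewrite /= ?mulr1 ?mulr0 ?addr0 ?add0r.
Qed.

Lemma derive_row2 (W : normedModType R) (g : V2 -> W) x v : differentiable g x ->
  'D_v g x = v ord0 ord0 *: 'D_(ej ord0) g x + v ord0 ord_max *: 'D_(ej ord_max) g x.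
Proof. by move=> dg; rewrite !deriveE// {1}[v]row2E linearD !linearZ. Qed.

Lemma frameE (xi : E3) : xi = xi.1 ord0 ord0 *: d_x R ord0 +
  xi.1 ord0 ord_max *: d_x R ord_max + xi.2 *: d_theta R.
Proof.
case: xi => v t; rewrite [v in LHS]row2E; congr pair; rewrite /=.
  by rewrite scaler0 addr0.
by rewrite !scaler0 !add0r /GRing.scale /= mulr1.
Qed.

Lemma derive_frame (W : normedModType R) (g : E3 -> W) y xi : differentiable g y ->
  'D_xi g y = xi.1 ord0 ord0 *: 'D_(d_x R ord0) g y +
    xi.1 ord0 ord_max *: 'D_(d_x R ord_max) g y + xi.2 *: 'D_(d_theta R) g y.
Proof. by move=> dg; rewrite !deriveE// {1}[xi]frameE !linearD !linearZ. Qed.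

Definition ddir (t : R) : V2 := - sin t *: ej ord0 + cos t *: ej ord_max.

Lemma dirE (t : R) : dir t = cos t *: ej ord0 + sin t *: ej ord_max.
Proof. by rewrite [LHS]row2E !mxE. Qed.

Lemma dir_neq0 (t : R) : dir t != 0.
Proof.
apply/eqP => d0; have := cos2Dsin2 t.
have := congr1 (fun v : V2 => v ord0 ord0) d0; rewrite !mxE /= => ->.
have := congr1 (fun v : V2 => v ord0 ord_max) d0; rewrite !mxE /= => ->.
by rewrite !expr0n addr0 => /eqP; rewrite eq_sym oner_eq0.
Qed.

Lemma differentiable_cos (t : R) : differentiable (cos : R -> R) t.
Proof. exact/derivable1_diffP/derivable_cos. Qed.

Lemma differentiable_sin (t : R) : differentiable (sin : R -> R) t.
Proof. exact/derivable1_diffP/derivable_sin. Qed.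

Lemma derivable_dir (t : R) : derivable (@dir R) t 1.
Proof.
apply/derivable_mxP => i j; rewrite ord1; case: (ord2_cases j) => -> /=.
  rewrite (_ : (fun _ => _) = cos); first exact: derivable_cos.
  by apply/funext => s; rewrite mxE.
rewrite (_ : (fun _ => _) = sin); first exact: derivable_sin.
by apply/funext => s; rewrite mxE.
Qed.

Lemma derive_dir (t : R) : 'D_1 (@dir R) t = ddir t.
Proof.
rewrite derive_mx; last exact: derivable_dir.
apply/rowP => j; rewrite !mxE /=; case: (ord2_cases j) => -> /=.
  rewrite (_ : (fun _ => _) = cos); last by apply/funext => s; rewrite mxE.
  by rewrite derive_val mulr1 mulr0 addr0.
rewrite (_ : (fun _ => _) = sin); last by apply/funext => s; rewrite mxE.
by rewrite derive_val mulr1 mulr0 add0r.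
Qed.

Lemma diff_dir (t s : R) : 'd (@dir R) t s = s *: ddir t.
Proof. by rewrite deriv1E ?derive1E ?derive_dir//; exact: derivable_dir. Qed.

Lemma differentiable_dir (t : R) : differentiable (@dir R) t.
Proof. exact/derivable1_diffP/derivable_dir. Qed.

Lemma differentiable_fst (U W : normedModType R) (y : U * W) :
  differentiable (fst : U * W -> U) y.
Proof. apply: linear_differentiable. by move=> z; apply: cvg_fst. Qed.

Lemma differentiable_snd (U W : normedModType R) (y : U * W) :
  differentiable (snd : U * W -> W) y.
Proof. apply: linear_differentiable. by move=> z; apply: cvg_snd. Qed.

Lemma diff_fst (U W : normedModType R) (y : U * W) :
  'd (fst : U * W -> U) y = fst :> (U * W -> U).
Proof. apply: diff_lin. by move=> z; apply: cvg_fst. Qed.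

Lemma diff_snd (U W : normedModType R) (y : U * W) :
  'd (snd : U * W -> W) y = snd :> (U * W -> W).
Proof. apply: diff_lin. by move=> z; apply: cvg_snd. Qed.

Lemma derive_snd (U : normedModType R) (y xi : U * R) :
  'D_xi (snd : U * R -> R) y = xi.2.
Proof. by rewrite deriveE ?diff_snd//; exact: differentiable_snd. Qed.

Lemma derive_comp_fst (U : normedModType R) (g : U -> R) (y xi : U * R) :
  differentiable g y.1 -> 'D_xi (fun z : U * R => g z.1) y = 'D_(xi.1) g y.1.
Proof.
move=> dg; have df := @differentiable_fst U R y.
have dc : differentiable (g \o fst) y by exact: differentiable_comp.
rewrite [LHS](deriveE _ dc) deriveE//.
by rewrite (diff_comp df dg) /= diff_fst.
Qed.

Lemma open_fst (U W : topologicalType) (D : set U) :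
  open D -> open [set y : U * W | D y.1].
Proof. by move=> oD; apply: open_comp => // y _; exact: cvg_fst. Qed.

Lemma Ck_fst k (U : normedModType R) (D : set U) (g : U -> R) : open D ->
  Ck k D g -> Ck k [set y : U * R | D y.1] (fun y => g y.1).
Proof.
move=> oD; elim: k g => [|k IH] g.
  move=> cg y Dy; apply: (@continuous_comp _ _ _ fst g); first exact: cvg_fst.
  exact: cg.
move=> [dg Dg]; split=> [y Dy|xi].
  by apply: (@differentiable_comp _ _ _ _ fst g);
    [exact: differentiable_fst|exact: dg].
apply: eq_Ck (IH _ (Dg xi.1)); first exact: open_fst.
by move=> y; rewrite inE => Dy; rewrite derive_comp_fst//; exact: dg.
Qed.

(** The two statements are proved together, each being the derivative of the
    other up to sign. *)
Lemma Ck_cos_sin k (D : set E3) : open D ->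
  Ck k D (fun y : E3 => cos y.2) /\ Ck k D (fun y : E3 => sin y.2).
Proof.
move=> oD; elim: k => [|k [IHc IHs]].
  split=> y _.
    by apply: (@continuous_comp _ _ _ snd cos); [exact: cvg_snd|exact: continuous_cos].
  by apply: (@continuous_comp _ _ _ snd sin); [exact: cvg_snd|exact: continuous_sin].
split; split=> [y Dy|xi].
- by apply: (@differentiable_comp _ _ _ _ snd cos);
    [exact: differentiable_snd|exact: differentiable_cos].
- apply: eq_Ck (CkN oD (CkM oD (Ck_cst k D xi.2) IHs)) => // y _.
  have := @derive_comp_R R _ cos snd y xi; rewrite derive_snd => ->.
  + by rewrite derive_val !fctE mulNr mulrC.
  + exact: differentiable_snd.
  + exact: differentiable_cos.
- by apply: (@differentiable_comp _ _ _ _ snd sin);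
    [exact: differentiable_snd|exact: differentiable_sin].
- apply: eq_Ck (CkM oD (Ck_cst k D xi.2) IHc) => // y _.
  have := @derive_comp_R R _ sin snd y xi; rewrite derive_snd => ->.
  + by rewrite derive_val !fctE mulrC.
  + exact: differentiable_snd.
  + exact: differentiable_sin.
Qed.

(** The Hilbert form at (x, t) only involves F near the vector dir t, so every
    coefficient below is a function on the tangent bundle composed with this map. *)
Definition polar (y : E3) : V2 * V2 := (y.1, dir y.2).

Lemma differentiable_polar y : differentiable polar y.
Proof.
apply: differentiable_pair; first exact: differentiable_fst.
apply: (@differentiable_comp _ _ _ _ snd (@dir R)).
  exact: differentiable_snd.
exact: differentiable_dir.
Qed.

Lemma diff_polar y xi : 'd polar y xi = (xi.1, xi.2 *: ddir y.2).
Proof.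
have df := @differentiable_fst V2 R y.
have ds := @differentiable_snd V2 R y.
have dd := differentiable_dir y.2.
have dc : differentiable (@dir R \o snd) y by exact: differentiable_comp.
have e1 : 'd (@dir R \o snd) y xi = xi.2 *: ddir y.2.
  apply: (etrans (congr1 (@^~ xi) (diff_comp ds dd))).
  by rewrite /= diff_dir diff_snd.
apply: (etrans (congr1 (@^~ xi) (diff_pair df dc))); congr pair => //.
by rewrite diff_fst.
Qed.

Lemma derive_polar (g : V2 * V2 -> R) y xi : differentiable g (polar y) ->
  'D_xi (g \o polar) y = 'D_(xi.1, 0) g (polar y) + xi.2 *
    (cos y.2 * 'D_(0, ej ord_max) g (polar y) - sin y.2 * 'D_(0, ej ord0) g (polar y)).
Proof.
move=> dg; have dp := differentiable_polar y.
have dc : differentiable (g \o polar) y by exact: differentiable_comp.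
rewrite [LHS](deriveE _ dc) !(deriveE _ dg) (diff_comp dp dg) /= diff_polar.
have -> : (xi.1, xi.2 *: ddir y.2) = (xi.1, 0) +
    xi.2 *: (cos y.2 *: ((0 : V2), ej ord_max) - sin y.2 *: ((0 : V2), ej ord0)).
  congr pair; rewrite /=; first by rewrite !scaler0 subrr scaler0 addr0.
  by rewrite add0r /ddir scaleNr addrC.
by rewrite linearD linearZ linearB !linearZ.
Qed.

(** Derivatives of the composite are combinations, with coefficients in cos t and
    sin t, of derivatives of g composed with [polar], whence the induction. *)
Lemma Ck_polar k (D : set V2) (g : V2 * V2 -> R) : open D ->
  Ck k [set z | D z.1 /\ z.2 != 0] g ->
  Ck k [set y : E3 | D y.1] (g \o polar).
Proof.
move=> oD; have oD3 := @open_fst V2 R D oD.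
have pD y : D y.1 -> D (polar y).1 /\ (polar y).2 != 0.
  by move=> Dy; split=> //; exact: dir_neq0.
elim: k g => [|k IH] g.
  move=> cg y Dy; apply: continuous_comp; last exact/cg/pD.
  exact/differentiable_continuous/differentiable_polar.
move=> [dg Dg]; split=> [y Dy|xi].
  by apply: differentiable_comp; [exact: differentiable_polar|exact/dg/pD].
have [Cc Cs] := Ck_cos_sin k oD3.
have := CkD oD3 (IH _ (Dg (xi.1, 0))) (CkM oD3 (Ck_cst k _ xi.2)
  (CkD oD3 (CkM oD3 Cc (IH _ (Dg (0, ej ord_max))))
    (CkN oD3 (CkM oD3 Cs (IH _ (Dg (0, ej ord0))))))).
apply: eq_Ck => // y; rewrite inE => Dy.
exact: esym (derive_polar xi (dg _ (pD _ Dy))).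
Qed.

End polar.

(** * The Reeb field of a contact form in coordinates *)

Section contact.
Context (R : realType).
Notation V2 := 'rV[R]_2.
Notation E3 := (V2 * R)%type.
Local Notation x0 xi := ((xi : E3).1 ord0 ord0).
Local Notation x1 xi := ((xi : E3).1 ord0 ord_max).
Notation dx0 := (d_x R ord0).
Notation dx1 := (d_x R ord_max).
Notation dt := (d_theta R).

(** The coefficient of dx^0 /\ dx^1 in dA for A = a0 dx^0 + a1 dx^1. *)
Definition curl (a0 a1 : E3 -> R) (y : E3) : R := 'D_dx0 a1 y - 'D_dx1 a0 y.
(** The coefficient of dt /\ dx^0 /\ dx^1 in A /\ dA for A = a0 dx^0 + a1 dx^1. *)
Definition vol_coef (a0 a1 : E3 -> R) (y : E3) : R :=
  a1 y * 'D_dt a0 y - a0 y * 'D_dt a1 y.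
Definition reeb0 (a0 a1 : E3 -> R) (y : E3) : R := - 'D_dt a1 y / vol_coef a0 a1 y.
Definition reeb1 (a0 a1 : E3 -> R) (y : E3) : R := 'D_dt a0 y / vol_coef a0 a1 y.
Definition reebt (a0 a1 : E3 -> R) (y : E3) : R := curl a0 a1 y / vol_coef a0 a1 y.
(** The kernel of a 2-form in dimension three is spanned by its dual vector, here
    with coordinates the coefficients of dA; dividing by [vol_coef] makes A equal
    to 1 on it. *)
Definition reeb_vector (a0 a1 : E3 -> R) (y : E3) : E3 :=
  reeb0 a0 a1 y *: dx0 + reeb1 a0 a1 y *: dx1 + reebt a0 a1 y *: dt.

Lemma frame_coords (p q t : R) : let xi : E3 := p *: dx0 + q *: dx1 + t *: dt in
  [/\ x0 xi = p, x1 xi = q & xi.2 = t].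
Proof.
split; [rewrite !mxE /=; ring | rewrite !mxE /=; ring |].
by rewrite /= !scaler0 !add0r; exact: mulr1.
Qed.

Lemma derive_reeb (a0 a1 W : E3 -> R) (y : E3) : differentiable W y ->
  'D_(reeb_vector a0 a1 y) W y =
  reeb0 a0 a1 y * 'D_dx0 W y + reeb1 a0 a1 y * 'D_dx1 W y +
    reebt a0 a1 y * 'D_dt W y.
Proof. by move=> dW; rewrite !deriveE// !linearD !linearZ. Qed.

Lemma d_x0E : [/\ x0 dx0 = 1, x1 dx0 = 0 & dx0.2 = 0].
Proof. by split; rewrite ?mxE. Qed.
Lemma d_x1E : [/\ x0 dx1 = 0, x1 dx1 = 1 & dx1.2 = 0].
Proof. by split; rewrite ?mxE. Qed.
Lemma d_thetaE : [/\ x0 dt = 0, x1 dt = 0 & dt.2 = 1].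
Proof. by split; rewrite ?mxE. Qed.

Section form.
Context (D : set E3) (H : E3 -> E3 -> R) (a0 a1 : E3 -> R).
Context (oD : open D) (da0 : forall y, D y -> differentiable a0 y)
  (da1 : forall y, D y -> differentiable a1 y)
  (HE : forall y xi, D y -> H y xi = a0 y * x0 xi + a1 y * x1 xi).

Lemma derive_form y v w : D y ->
  'D_v (fun z => H z w) y = x0 w * 'D_v a0 y + x1 w * 'D_v a1 y.
Proof.
move=> Dy.
have d0 : derivable a0 y v by exact/diff_derivable/da0.
have d1 : derivable a1 y v by exact/diff_derivable/da1.
transitivity ('D_v (x0 w *: a0 + x1 w *: a1) y).
  apply: (eq_derive_open _ oD) => // z; rewrite inE => Dz.
  by rewrite HE// mulrC [a1 z * _]mulrC.
have z0 : derivable (x0 w *: a0) y v by exact: derivableZ.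
have z1 : derivable (x1 w *: a1) y v by exact: derivableZ.
apply: (etrans (deriveD z0 z1)); congr (_ + _); exact: deriveZ.
Qed.

Lemma ext_dE y v w : D y -> ext_d H y v w =
  curl a0 a1 y * (x0 v * x1 w - x1 v * x0 w)
  + 'D_dt a0 y * (v.2 * x0 w - w.2 * x0 v)
  + 'D_dt a1 y * (v.2 * x1 w - w.2 * x1 v).
Proof.
move=> Dy; rewrite /ext_d !derive_form//.
rewrite (derive_frame v (da0 Dy)) (derive_frame v (da1 Dy)).
rewrite (derive_frame w (da0 Dy)) (derive_frame w (da1 Dy)) /curl.
have expand (b00 b01 b0t b10 b11 b1t v0 v1 vt w0 w1 wt : R) :
  w0 * (v0 * b00 + v1 * b01 + vt * b0t) + w1 * (v0 * b10 + v1 * b11 + vt * b1t)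
  - (v0 * (w0 * b00 + w1 * b01 + wt * b0t) + v1 * (w0 * b10 + w1 * b11 + wt * b1t))
  = (b10 - b01) * (v0 * w1 - v1 * w0) + b0t * (vt * w0 - wt * v0)
    + b1t * (vt * w1 - wt * v1) by ring.
exact: expand.
Qed.

Lemma wedge_formE y u v w : D y -> wedge12 (H y) (ext_d H y) u v w =
  vol_coef a0 a1 y * (u.2 * (x0 v * x1 w - x1 v * x0 w)
   - v.2 * (x0 u * x1 w - x1 u * x0 w) + w.2 * (x0 u * x1 v - x1 u * x0 v)).
Proof. by move=> Dy; rewrite /wedge12 !ext_dE// !HE// /vol_coef; ring. Qed.

(** Uniqueness: A(xi) = 1 and dA(xi, .) = 0 tested on the three coordinate vectors
    determine [vol_coef] times each coordinate of xi. *)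
Lemma reeb_formE y : D y -> vol_coef a0 a1 y != 0 ->
  get [set xi | H y xi = 1 /\ forall eta, ext_d H y xi eta = 0] =
  reeb_vector a0 a1 y.
Proof.
move=> Dy P0.
have [p0 p1 p2] := frame_coords (reeb0 a0 a1 y) (reeb1 a0 a1 y) (reebt a0 a1 y).
have sol : [set xi | H y xi = 1 /\ forall eta, ext_d H y xi eta = 0]
    (reeb_vector a0 a1 y).
  rewrite /=; split=> [|eta]; rewrite ?HE// ?ext_dE// p0 p1 ?p2;
    rewrite /reeb0 /reeb1 /reebt; move: P0; rewrite /vol_coef => P0; field => //.
have [/= H1 H2] := getPex (ex_intro _ _ sol).
move: (get _) H1 H2 => xi H1 H2.
move: H1; rewrite HE// => H1.
have := H2 dt; have := H2 dx0; have := H2 dx1; rewrite !ext_dE//.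
have [-> -> ->] := d_thetaE; have [-> -> ->] := d_x0E.
have [-> -> ->] := d_x1E => e1 e0 et.
have {}et : 'D_dt a0 y * x0 xi + 'D_dt a1 y * x1 xi = 0.
  by apply: oppr_inj; rewrite oppr0 -[RHS]et; ring.
have {}e0 : 'D_dt a0 y * xi.2 - curl a0 a1 y * x1 xi = 0 by rewrite -[RHS]e0; ring.
have {}e1 : 'D_dt a1 y * xi.2 + curl a0 a1 y * x0 xi = 0 by rewrite -[RHS]e1; ring.
have Pp : vol_coef a0 a1 y * x0 xi = - 'D_dt a1 y.
  rewrite /vol_coef; transitivity (- 'D_dt a1 y * (a0 y * x0 xi + a1 y * x1 xi)
    + a1 y * ('D_dt a0 y * x0 xi + 'D_dt a1 y * x1 xi)); first ring.
  by rewrite H1 et mulr0 addr0 mulr1.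
have Pq : vol_coef a0 a1 y * x1 xi = 'D_dt a0 y.
  rewrite /vol_coef; transitivity ('D_dt a0 y * (a0 y * x0 xi + a1 y * x1 xi)
    - a0 y * ('D_dt a0 y * x0 xi + 'D_dt a1 y * x1 xi)); first ring.
  by rewrite H1 et mulr0 subr0 mulr1.
have Pt : vol_coef a0 a1 y * xi.2 = curl a0 a1 y.
  rewrite /vol_coef; transitivity (curl a0 a1 y * (a0 y * x0 xi + a1 y * x1 xi)
    + a1 y * ('D_dt a0 y * xi.2 - curl a0 a1 y * x1 xi)
    - a0 y * ('D_dt a1 y * xi.2 + curl a0 a1 y * x0 xi)); first ring.
  by rewrite H1 e0 e1 !mulr0 addr0 subr0 mulr1.
rewrite [LHS]frameE /reeb_vector.
congr (_ *: _ + _ *: _ + _ *: _).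
- by rewrite /reeb0 -Pp mulrC mulKf.
- by rewrite /reeb1 -Pq mulrC mulKf.
- by rewrite /reebt -Pt mulrC mulKf.
Qed.
End form.
End contact.

(** * Rescaling the contact form by a function on the base *)

Section conformal_change.
Context (R : realType).
Notation V2 := 'rV[R]_2.
Notation E3 := (V2 * R)%type.
Notation e0 := (ej R ord0).
Notation e1 := (ej R ord_max).
Notation dx0 := (d_x R ord0).
Notation dx1 := (d_x R ord_max).
Notation dt := (d_theta R).

(** The derivative along the Reeb field of a function of the base point only. *)
Definition reeb_base (a0 a1 : E3 -> R) (u : V2 -> R) (y : E3) : R :=
  reeb0 a0 a1 y * 'D_e0 u y.1 + reeb1 a0 a1 y * 'D_e1 u y.1.

Lemma derive_reeb_vector1 (a0 a1 : E3 -> R) (u : V2 -> R) (y : E3) :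
  differentiable u y.1 ->
  'D_((reeb_vector a0 a1 y).1) u y.1 = reeb_base a0 a1 u y.
Proof.
move=> du; rewrite derive_row2//.
by have [-> -> _] := frame_coords (reeb0 a0 a1 y) (reeb1 a0 a1 y) (reebt a0 a1 y).
Qed.

Lemma derive_reeb_base (a0 a1 : E3 -> R) (u : V2 -> R) (y : E3) :
  differentiable u y.1 ->
  'D_(reeb_vector a0 a1 y) (fun z : E3 => u z.1) y = reeb_base a0 a1 u y.
Proof. by move=> du; rewrite derive_comp_fst// derive_reeb_vector1. Qed.

Definition scaled (f : V2 -> R) (a : E3 -> R) (y : E3) : R := expR (f y.1) * a y.

Lemma derive_scaled f a y v : differentiable f y.1 -> differentiable a y ->
  'D_v (scaled f a) y = expR (f y.1) * ('D_v a y + a y * 'D_(v.1) f y.1).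
Proof.
move=> df da.
have dff : differentiable (fun z : E3 => f z.1) y.
  by apply: (@differentiable_comp _ _ _ _ fst f) => //; exact: differentiable_fst.
have de : differentiable (expR \o (fun z : E3 => f z.1)) y.
  by apply: differentiable_comp => //; exact: differentiable_expR.
have vde : derivable (expR \o (fun z : E3 => f z.1)) y v by exact/diff_derivable.
have vda : derivable a y v by exact/diff_derivable.
apply: (etrans (deriveM vde vda)).
rewrite derive_expR_comp// derive_comp_fst//.
have factor (e p q r : R) : e * q + p * (e * r) = e * (q + p * r) by ring.
exact: factor.
Qed.

Section at_point.
Context (f : V2 -> R) (a0 a1 : E3 -> R) (y : E3).
Context (df : differentiable f y.1) (da0 : differentiable a0 y)
  (da1 : differentiable a1 y).
Let e := expR (f y.1).

Lemma curl_scaled : curl (scaled f a0) (scaled f a1) y =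
  e * (curl a0 a1 y + 'D_e0 f y.1 * a1 y - 'D_e1 f y.1 * a0 y).
Proof.
rewrite /curl !derive_scaled// -/e.
have factor (k p q r t z w : R) :
  k * (p + q * r) - k * (t + z * w) = k * (p - t + r * q - w * z) by ring.
exact: factor.
Qed.

Lemma derive_dt_scaled a : differentiable a y ->
  'D_dt (scaled f a) y = e * 'D_dt a y.
Proof. by move=> da; rewrite derive_scaled//= derive0 mulr0 addr0. Qed.

(** A /\ df /\ A = 0, so the derivative of the factor does not contribute. *)
Lemma vol_coef_scaled :
  vol_coef (scaled f a0) (scaled f a1) y = e ^+ 2 * vol_coef a0 a1 y.
Proof. by rewrite /vol_coef !derive_dt_scaled// /scaled -/e; ring. Qed.

Context (vol0 : vol_coef a0 a1 y != 0).
Let e0_neq : e != 0. Proof. by rewrite /e expR_eq0. Qed.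

Lemma reeb0_scaled : reeb0 (scaled f a0) (scaled f a1) y = e^-1 * reeb0 a0 a1 y.
Proof.
by rewrite /reeb0 vol_coef_scaled derive_dt_scaled//; field; rewrite vol0 e0_neq.
Qed.

Lemma reeb1_scaled : reeb1 (scaled f a0) (scaled f a1) y = e^-1 * reeb1 a0 a1 y.
Proof.
by rewrite /reeb1 vol_coef_scaled derive_dt_scaled//; field; rewrite vol0 e0_neq.
Qed.

(** The vertical component picks up the term df /\ A of d(e^f A); the base
    components do not, since df and A vanish on d/dt. *)
Lemma reebt_scaled : reebt (scaled f a0) (scaled f a1) y = e^-1 * (reebt a0 a1 y +
  ('D_e0 f y.1 * a1 y - 'D_e1 f y.1 * a0 y) / vol_coef a0 a1 y).
Proof.
rewrite /reebt vol_coef_scaled curl_scaled.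
have reduce (k c d g p : R) : k != 0 -> p != 0 ->
  k * (c + d - g) / (k ^+ 2 * p) = k^-1 * (c / p + (d - g) / p).
  by move=> k0 p0; field; rewrite k0 p0.
exact: reduce.
Qed.

Lemma reeb_base_scaled u : reeb_base (scaled f a0) (scaled f a1) u y =
  e^-1 * reeb_base a0 a1 u y.
Proof. by rewrite /reeb_base reeb0_scaled reeb1_scaled -!mulrA -mulrDr. Qed.

(** The rescaled field is e^{-f} (X + zeta d/dt), and it differentiates e^{-f} W:
    the factor e^{-f} contributes - (Xf) W, the vertical component zeta dW/dt. *)
Lemma derive_reeb_rescaled (W : E3 -> R) : differentiable W y ->
  e ^+ 2 * vol_coef a0 a1 y *
    'D_(reeb_vector (scaled f a0) (scaled f a1) y)
      (fun z => (expR (f z.1))^-1 * W z) y =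
  vol_coef a0 a1 y * 'D_(reeb_vector a0 a1 y) W y +
  (('D_e0 f y.1 * a1 y - 'D_e1 f y.1 * a0 y) * 'D_dt W y
   - vol_coef a0 a1 y * reeb_base a0 a1 f y * W y).
Proof.
move=> dW.
have -> : (fun z : E3 => (expR (f z.1))^-1 * W z) = scaled (fun x => - f x) W.
  by apply/funext => z; rewrite /scaled expRN.
have dNf : differentiable (fun x => - f x) y.1 by exact: differentiableN.
rewrite derive_scaled// expRN -/e.
have -> (v : V2) : 'D_v (fun x => - f x) y.1 = - 'D_v f y.1.
  by rewrite [LHS]deriveN//; exact: diff_derivable.
rewrite !derive_reeb// derive_reeb_vector1// reeb_base_scaled.
rewrite reeb0_scaled reeb1_scaled reebt_scaled.
have reduce (k p q0 q1 qt g w w0 w1 wt b : R) : k != 0 -> p != 0 ->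
  k ^+ 2 * p * (k^-1 * (k^-1 * q0 * w0 + k^-1 * q1 * w1 + k^-1 * (qt + g / p) * wt
    + w * - (k^-1 * b))) =
  p * (q0 * w0 + q1 * w1 + qt * wt) + (g * wt - p * b * w).
  by move=> k0 p0; field; rewrite k0 p0.
exact: reduce.
Qed.

End at_point.

(** The correction term of [derive_reeb_rescaled] is a derivative along the fibre,
    as [vol_coef] times the base part of the Reeb field is the
    t-derivative of (- a1, a0). *)
Lemma derive_dt_primitive (a0 a1 W : E3 -> R) (f : V2 -> R) (y : E3) (f0 f1 : R) :
  f0 = 'D_e0 f y.1 -> f1 = 'D_e1 f y.1 ->
  differentiable a0 y -> differentiable a1 y -> differentiable W y ->
  vol_coef a0 a1 y != 0 ->
  'D_dt (W * (f0 *: a1 - f1 *: a0)) y =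
  (f0 * a1 y - f1 * a0 y) * 'D_dt W y - vol_coef a0 a1 y * reeb_base a0 a1 f y * W y.
Proof.
move=> f0E f1E da0 da1 dW v0.
have v0' : derivable a0 y dt by exact/diff_derivable.
have v1' : derivable a1 y dt by exact/diff_derivable.
have vW : derivable W y dt by exact/diff_derivable.
have z0 : derivable (f1 *: a0) y dt by exact: derivableZ.
have z1 : derivable (f0 *: a1) y dt by exact: derivableZ.
have zB : derivable (f0 *: a1 - f1 *: a0) y dt by exact: derivableB.
have eB : 'D_dt (f0 *: a1 - f1 *: a0) y = f0 * 'D_dt a1 y - f1 * 'D_dt a0 y.
  by apply: (etrans (deriveB z1 z0)); congr (_ - _); exact: deriveZ.
apply: (etrans (deriveM vW zB)); rewrite eB /reeb_base -f0E -f1E /reeb0 /reeb1.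
have reduce (w wt b0 b1 c0 c1 p : R) : p != 0 ->
  w * (f0 * c1 - f1 * c0) + (f0 * b1 - f1 * b0) * wt =
  (f0 * b1 - f1 * b0) * wt - p * (- c1 / p * f0 + c0 / p * f1) * w.
  by move=> p0; field.
exact: reduce.
Qed.

End conformal_change.

(** * The Hilbert form in a chart *)

Section charts.
Context (R : realType) (T : topologicalType) (S : atlas T 'rV[R]_2).
Notation V2 := 'rV[R]_2.
Notation E3 := (V2 * R)%type.
Notation e0 := (ej R ord0).
Notation e1 := (ej R ord_max).
Notation dx0 := (d_x R ord0).
Notation dx1 := (d_x R ord_max).
Notation dt := (d_theta R).
Context (oS : forall i, open (dom S i)).
Implicit Types (F : tangent S -> R) (i : idx S) (y : E3).

Definition tube i : set E3 := [set y | dom S i y.1].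

Lemma open_tube i : open (tube i).
Proof. exact/open_fst/oS. Qed.

Definition hilbert_coef F i j y : R := hilbert_form F i y (d_x R j).

Definition norm_chart F i (z : V2 * V2) : R := F (tvec i z.1 z.2).

Definition smooth_norm F := forall i,
  smooth_on [set z : V2 * V2 | dom S i z.1 /\ z.2 != 0] (norm_chart F i).

(** The Hilbert form is defined by derivatives in the fibre variable alone, while
    smoothness is known jointly in both variables. *)
Lemma derive_partial (g : V2 * V2 -> R) (x v w : V2) :
  'D_w (fun v' => g (x, v')) v = 'D_(0, w) g (x, v) /\
  (derivable (fun v' => g (x, v')) v w <-> derivable g (x, v) (0, w)).
Proof.
rewrite /derive /derivable.
have -> : (fun h => h^-1 *: ((g \o shift (x, v)) (h *: (0, w)) - g (x, v))) =
  (fun h => h^-1 *: (((fun v' => g (x, v')) \o shift v) (h *: w) - g (x, v))).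
  apply/funext => h; congr (_ *: (_ - _)); rewrite /=; congr g; congr pair.
  by rewrite /= scaler0 add0r.
by [].
Qed.

Section norm.
Context (F : tangent S -> R) (sF : smooth_norm F).

Lemma diff_norm_chart i y : tube i y -> differentiable (norm_chart F i) (polar y).
Proof.
move=> Dy; apply: (Ck_differentiable (@sF i 1)).
by split=> //; exact: dir_neq0.
Qed.

Lemma hilbert_formE i y xi : tube i y ->
  hilbert_form F i y xi = 'D_(0, xi.1) (norm_chart F i) (polar y).
Proof.
by move=> Dy; have [<- _] := derive_partial (norm_chart F i) y.1 (dir y.2) xi.1.
Qed.

Lemma Ck_hilbert_coef k i j : Ck k (tube i) (hilbert_coef F i j).
Proof.
have := Ck_polar (@oS i) (Ck_derive (0, ej R j) (@sF i k.+1)).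
apply: eq_Ck; first exact: open_tube.
by move=> y; rewrite inE => Dy; rewrite /hilbert_coef hilbert_formE.
Qed.

Lemma diff_hilbert_coef i j y : tube i y -> differentiable (hilbert_coef F i j) y.
Proof. exact: (Ck_differentiable (Ck_hilbert_coef 1 i j)). Qed.

Lemma hilbert_form_coef i y xi : tube i y -> hilbert_form F i y xi =
  hilbert_coef F i ord0 y * xi.1 ord0 ord0 +
  hilbert_coef F i ord_max y * xi.1 ord0 ord_max.
Proof.
move=> Dy; rewrite /hilbert_coef !hilbert_formE// !deriveE; [|exact: diff_norm_chart..].
have -> : (0, xi.1) = xi.1 ord0 ord0 *: ((0 : V2), e0) +
    xi.1 ord0 ord_max *: ((0 : V2), e1).
  by congr pair => /=; [rewrite !scaler0 addr0|exact: row2E].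
rewrite linearD !linearZ /GRing.scale/=.
by rewrite mulrC [X in _ + X]mulrC.
Qed.

Lemma hilbert_form_conformal f i y xi : tube i y ->
  hilbert_form (conformal f F) i y xi = expR (f (par S i y.1)) * hilbert_form F i y xi.
Proof.
move=> Dy; rewrite /hilbert_form /conformal /=.
have d : derivable (fun v => F (tvec i y.1 v)) (dir y.2) xi.1.
  have [_ /iffRL] := derive_partial (norm_chart F i) y.1 (dir y.2) xi.1.
  by apply; apply/diff_derivable/(diff_norm_chart Dy).
exact: (deriveZ _ d).
Qed.

Definition contact_density i :=
  vol_coef (hilbert_coef F i ord0) (hilbert_coef F i ord_max).

Lemma contact_volumeE i y u v w : tube i y -> contact_volume F i y u v w =
  contact_density i y *
  (u.2 * (v.1 ord0 ord0 * w.1 ord0 ord_max - v.1 ord0 ord_max * w.1 ord0 ord0)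
   - v.2 * (u.1 ord0 ord0 * w.1 ord0 ord_max - u.1 ord0 ord_max * w.1 ord0 ord0)
   + w.2 * (u.1 ord0 ord0 * v.1 ord0 ord_max - u.1 ord0 ord_max * v.1 ord0 ord0)).
Proof.
apply: (wedge_formE (@open_tube i)) => z; first exact: diff_hilbert_coef.
  exact: diff_hilbert_coef.
by move=> xi; exact: hilbert_form_coef.
Qed.

Lemma contact_volume_frame i y : tube i y ->
  contact_volume F i y dt dx0 dx1 = contact_density i y.
Proof.
move=> Dy; rewrite contact_volumeE//.
have [-> -> ->] := d_thetaE R; have [-> -> ->] := d_x0E R; have [-> -> ->] := d_x1E R.
by ring.
Qed.

Context (f : T -> R) (sf : smooth_fun S f).

Lemma diff_f i y : tube i y -> differentiable (f \o par S i) y.1.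
Proof. exact: (Ck_differentiable (@sf 1 i)). Qed.

Let a j i := scaled (f \o par S i) (hilbert_coef F i j).

Lemma diff_scaled j i y : tube i y -> differentiable (a j i) y.
Proof.
move=> Dy; apply: (@differentiableM _ _ (fun z : E3 => expR (f (par S i z.1)))).
  apply: (@differentiable_comp _ _ _ _ (fun z : E3 => f (par S i z.1)) expR).
    apply: (@differentiable_comp _ _ _ _ fst (f \o par S i)).
      exact: differentiable_fst.
    exact: diff_f.
  exact: differentiable_expR.
exact: diff_hilbert_coef.
Qed.

Lemma hilbert_form_scaled i y xi : tube i y -> hilbert_form (conformal f F) i y xi =
  a ord0 i y * xi.1 ord0 ord0 + a ord_max i y * xi.1 ord0 ord_max.
Proof.
by move=> Dy; rewrite hilbert_form_conformal// hilbert_form_coef// mulrDr !mulrA.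
Qed.

(** On a surface, a conformal factor on the base multiplies A /\ dA by its square. *)
Lemma contact_volume_conformal i y u v w : tube i y ->
  contact_volume (conformal f F) i y u v w =
  expR (f (par S i y.1)) ^+ 2 * contact_volume F i y u v w.
Proof.
move=> Dy; rewrite contact_volumeE//.
apply: (etrans (@wedge_formE R (tube i) (hilbert_form (conformal f F) i)
  (a ord0 i) (a ord_max i) (@open_tube i) (@diff_scaled _ i) (@diff_scaled _ i)
  (@hilbert_form_scaled i) y u v w Dy)).
by rewrite vol_coef_scaled ?mulrA//; [exact: diff_f|exact: diff_hilbert_coef..].
Qed.

Lemma reebE i y : tube i y -> contact_density i y != 0 ->
  reeb F i y = reeb_vector (hilbert_coef F i ord0) (hilbert_coef F i ord_max) y.
Proof.
move=> Dy v0; apply: (reeb_formE (@open_tube i)) => //.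
- exact: diff_hilbert_coef.
- exact: diff_hilbert_coef.
- by move=> z xi; exact: hilbert_form_coef.
Qed.

Lemma reeb_conformalE i y : tube i y -> contact_density i y != 0 ->
  reeb (conformal f F) i y = reeb_vector (a ord0 i) (a ord_max i) y.
Proof.
move=> Dy v0; apply: (reeb_formE (@open_tube i)) => //.
- exact: diff_scaled.
- exact: diff_scaled.
- by move=> z xi; exact: hilbert_form_scaled.
- rewrite vol_coef_scaled ?mulf_neq0 ?expf_neq0 ?expR_eq0//.
  + exact: diff_f.
  + exact: diff_hilbert_coef.
  + exact: diff_hilbert_coef.
Qed.

End norm.

(** The value taken by [angle_form] when there is no volume and angle form. *)
Lemma point_angle :
  (point : (tangent S -> tangent S -> R) * (tangent (HM S) -> R)).2 = (fun=> 0).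
Proof. reflexivity. Qed.

End charts.

(** * Volume and angle forms *)

Section volume_angle.
Context (R : realType) (T : topologicalType) (S : atlas T 'rV[R]_2).
Notation V2 := 'rV[R]_2.
Notation E3 := (V2 * R)%type.
Notation e0 := (ej R ord0).
Notation e1 := (ej R ord_max).
Notation dx0 := (d_x R ord0).
Notation dx1 := (d_x R ord_max).
Notation dt := (d_theta R).
Context (oS : forall i, open (dom S i)).
Implicit Types (F : tangent S -> R) (i : idx S) (y : E3)
  (Om : tangent S -> tangent S -> R) (a : tangent (HM S) -> R).

Lemma scalar0 (V : lmodType R) (g : V -> R) : scalar g -> g 0 = 0.
Proof.
move=> lg; have := lg 1 0 0; rewrite scaler0 addr0 mul1r => e.
by apply: (addrI (g 0)); rewrite addr0.
Qed.

Lemma scalar_comb (V : lmodType R) (g : V -> R) p q u v : scalar g ->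
  g (p *: u + q *: v) = p * g u + q * g v.
Proof.
move=> lg; rewrite lg; congr (_ + _).
by have := lg q v 0; rewrite addr0 => ->; rewrite scalar0// addr0.
Qed.

(** In dimension two an alternating form is a multiple of the determinant. *)
Lemma alternating_frame (B : V2 -> V2 -> R) :
  (forall w, scalar (B w) /\ scalar (B^~ w)) -> (forall v, B v v = 0) ->
  (exists v w, B v w != 0) -> B e0 e1 != 0.
Proof.
move=> lin alt [v [w]]; apply: contra_neq => o0.
have bl p q u u' w' : B (p *: u + q *: u') w' = p * B u w' + q * B u' w'.
  by have [_ l] := lin w'; exact: (scalar_comb p q u u' l).
have br p q u u' w' : B w' (p *: u + q *: u') = p * B w' u + q * B w' u'.
  by have [l _] := lin w'; exact: (scalar_comb p q u u' l).
have o1 : B e1 e0 = 0.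
  have := alt (1 *: e0 + 1 *: e1).
  rewrite (bl 1 1 e0 e1) (br 1 1 e0 e1 e0) (br 1 1 e0 e1 e1) !alt// o0.
  by rewrite !mul1r !add0r addr0.
have -> : B v w = v ord0 ord0 * B e0 w + v ord0 ord_max * B e1 w.
  by rewrite {1}(row2E v); exact: bl.
have ew u : B u w = w ord0 ord0 * B u e0 + w ord0 ord_max * B u e1.
  by rewrite {1}(row2E w); exact: br.
by rewrite (ew e0) (ew e1) !alt o0 o1; ring.
Qed.

Lemma volume_form_frame Om i x : volume_form Om -> dom S i x ->
  Om (tvec i x e0) (tvec i x e1) != 0.
Proof.
move=> [/(_ i)[lin [alt _]] nd] Dx.
apply: (alternating_frame (B := fun v w => Om (tvec i x v) (tvec i x w))).
- by move=> w; exact: lin.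
- by move=> w; exact: alt.
- exact: nd.
Qed.

Lemma dt_neq0 : dt != 0.
Proof. by apply/eqP => -[] /eqP; rewrite oner_eq0. Qed.

Section coeff.
Context F (sF : smooth_norm F) Om a (fva : finsler_volume_angle F Om a).

(** Evaluate alpha /\ Omega = A /\ dA on (d/dt, d/dx^0, d/dx^1); the form Omega
    vanishes when one argument is vertical. *)
Lemma angle_coef i y : tube i y -> [/\ Om (tvec i y.1 e0) (tvec i y.1 e1) != 0,
  a (HMvec i y dt) * Om (tvec i y.1 e0) (tvec i y.1 e1) = contact_density F i y &
  contact_density F i y != 0].
Proof.
move=> Dy; have [vO _ a0 aO _] := fva.
have om0 := volume_form_frame vO Dy.
have E : a (HMvec i y dt) * Om (tvec i y.1 e0) (tvec i y.1 e1) = contact_density F i y.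
  rewrite -(contact_volume_frame oS sF Dy) -aO//.
  have [tO _] := vO; have [lin _] := tO i.
  have [_ l1] := lin y.1 e1 Dy; have [_ l0] := lin y.1 e0 Dy.
  have drop (p q r o z z' : R) : z = 0 -> z' = 0 -> p * o = p * o - q * z + r * z'.
    by move=> -> ->; rewrite !mulr0 subr0 addr0.
  by apply: drop; [exact: scalar0 l1|exact: scalar0 l0].
split=> //; rewrite -E mulf_neq0//.
by apply: a0 => //; exact: dt_neq0.
Qed.

End coeff.

Lemma Ck_contact_density k F i : smooth_norm F -> Ck k (tube i) (contact_density F i).
Proof.
move=> sF.
have oT := open_tube oS (i := i).
apply: (CkD oT); last apply: (CkN oT); apply: (CkM oT);
 try exact: Ck_hilbert_coef; exact/Ck_derive/Ck_hilbert_coef.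
Qed.

Lemma continuous_fiber (g : E3 -> R) i x : dom S i x -> Ck 0 (tube i) g ->
  continuous (fun t : R => g (x, t)).
Proof.
move=> Dx cg t; apply: (@continuous_comp _ _ _ (fun t : R => (x, t)) g).
  apply/differentiable_continuous/differentiable_pair; first exact: differentiable_cst.
  exact/derivable1_diffP/derivable_id.
exact: cg.
Qed.

(** The defining equation is homogeneous in Omega, so a positive factor on the base
    multiplying A /\ dA is absorbed by Omega; the fibre orientation and the
    normalization of alpha are unaffected. *)
Lemma volume_angle_scale F F' Om a (h : T -> R) :
  (forall p, 0 < h p) -> smooth_fun S h ->
  (forall i y u v w, tube i y ->
     contact_volume F' i y u v w = h (par S i y.1) * contact_volume F i y u v w) ->
  finsler_volume_angle F Om a ->
  finsler_volume_angle F' (fun s t => h (tbase s) * Om s t) a.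
Proof.
move=> h0 sh cv [[tO nd] oa a0 aO ai]; split; [|exact: oa|exact: a0| |].
- split.
    move=> c; have [lin [alt smo]] := tO c; split; last split.
    + move=> x v Dx; have [l r] := lin x v Dx; split=> k u w; rewrite /=.
        by rewrite l mulrDr mulrCA.
      by rewrite r mulrDr mulrCA.
    + by move=> x v Dx; rewrite alt// mulr0.
    + move=> v w k; have := CkM (@oS c) (sh k c) (smo v w k).
      by [].
  move=> c x Dx; have [v [w n]] := nd c x Dx; exists v, w.
  by rewrite mulf_neq0//; apply: lt0r_neq0; exact: h0.
- move=> i y u v w Dy; rewrite (cv _ _ _ _ _ Dy) -(aO _ _ _ _ _ Dy) /wedge12.
  have factor (p q r s t z k : R) :
    p * (k * q) - r * (k * s) + t * (k * z) = k * (p * q - r * s + t * z) by ring.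
  exact: factor.
- move=> i x Dx; rewrite -(ai i x Dx) /fiber_integral.
  apply: eq_Rintegral => t _.
  have sg : fiber_sign F' i (x, t) = fiber_sign F i (x, t).
    by rewrite /fiber_sign cv// sgrM gtr0_sg ?mul1r//; exact: h0.
  by rewrite sg.
Qed.

Lemma volume_angle_conformal F (f : T -> R) Om a : smooth_norm F -> smooth_fun S f ->
  finsler_volume_angle F Om a ->
  finsler_volume_angle (conformal f F)
    (fun s t => expR (f (tbase s)) ^+ 2 * Om s t) a.
Proof.
move=> sF sf; apply: (volume_angle_scale (h := fun p => expR (f p) ^+ 2)).
- by move=> p; rewrite exprn_gt0// expR_gt0.
- move=> k i; have oi := @oS i.
  have := CkM oi (Ck_expR oi (sf k i)) (Ck_expR oi (sf k i)).
  by apply: eq_Ck => // x _; rewrite /= expr2.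
- by move=> i y u v w Dy; rewrite (contact_volume_conformal oS sF).
Qed.

Lemma volume_angle_conformalV F (f : T -> R) Om a : smooth_norm F -> smooth_fun S f ->
  finsler_volume_angle (conformal f F) Om a ->
  finsler_volume_angle F
    (fun s t => expR (f (tbase s)) ^- 2 * Om s t) a.
Proof.
move=> sF sf; apply: (volume_angle_scale (h := fun p => expR (f p) ^- 2)).
- by move=> p; rewrite invr_gt0 exprn_gt0// expR_gt0.
- move=> k i; have oi := @oS i.
  have := CkN oi (sf k i) => /(Ck_expR oi) sN.
  have := CkM oi sN sN.
  by apply: eq_Ck => // x _; rewrite /= -exprVn -expRN expr2.
- move=> i y u v w Dy; rewrite (contact_volume_conformal oS sF)// mulKf//.
  by rewrite expf_neq0// expR_eq0.
Qed.

Local Notation mu := (@lebesgue_measure R).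

Lemma integrable_continuous (g : R -> R) : continuous g ->
  mu.-integrable `[0, 2 * pi] (EFin \o g).
Proof.
move=> cg; apply: continuous_compact_integrable; first exact: segment_compact.
exact: continuous_subspaceT.
Qed.

(** By [angle_coef] the normalization says that the integral over the fibre of the
    absolute value of [contact_density] is [vol_circle] times the value of Omega on the coordinate frame.  Hence Omega
    and Omega' agree on that frame, and alpha and alpha' on d/dt. *)
Lemma angle_unique F Om a Om' a' i y : smooth_norm F ->
  finsler_volume_angle F Om a -> finsler_volume_angle F Om' a' ->
  tube i y -> a (HMvec i y dt) = a' (HMvec i y dt).
Proof.
move=> sF fa fa'; case: y => x t Dx.
pose J := \int[mu]_(t in `[0, 2 * pi]) `|contact_density F i (x, t)|.
have key Om1 a1 : finsler_volume_angle F Om1 a1 ->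
    (Om1 (tvec i x e0) (tvec i x e1))^-1 * J = vol_circle R.
  move=> f1; have [_ _ _ _ ai] := f1; rewrite -(ai i x Dx).
  rewrite -RintegralZl//; last first.
    apply: (@integrable_continuous (fun t => `|contact_density F i (x, t)|)) => s.
    apply: cvg_norm; exact: (continuous_fiber Dx (@Ck_contact_density 0 F i sF)).
  apply: eq_Rintegral => s _; rewrite mul1r.
  have [om0 Ea _] := angle_coef sF f1 (y := (x, s)) Dx.
  rewrite /fiber_sign (contact_volume_frame oS sF)// normrEsg.
  have drop (o h z : R) : o != 0 -> z * o = h ->
    o^-1 * (Num.sg h * h) = Num.sg h * z by move=> ? <-; field.
  exact: drop om0 Ea.
have vc : vol_circle R != 0 by rewrite mulf_neq0 ?pnatr_eq0// lt0r_neq0// pi_gt0.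
have E := key _ _ fa; have E' := key _ _ fa'.
have J0 : J != 0 by apply: contra_neq vc => J0; rewrite -E J0 mulr0.
have [om0 E1 _] := angle_coef sF fa (y := (x, t)) Dx.
have [om0' E1' _] := angle_coef sF fa' (y := (x, t)) Dx.
apply: (mulIf om0); rewrite E1 -E1'; congr (_ * _).
by apply: invr_inj; apply: (mulIf J0); rewrite /= E E'.
Qed.

End volume_angle.

(** * Calculus along a fibre, and the Reeb derivatives *)

Section fiber_calculus.
Context (R : realType) (U : normedModType R).
Implicit Types (K : U * R -> R) (g : R -> R).
Notation dt := ((0 : U, 1 : R)).

Lemma derive_fiber K (x : U) (t : R) :
  'D_1 (fun s => K (x, s)) t = 'D_dt K (x, t) /\
  (derivable (fun s => K (x, s)) t 1 <-> derivable K (x, t) dt).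
Proof.
rewrite /derive /derivable.
have -> : (fun h => h^-1 *: ((K \o shift (x, t)) (h *: dt) - K (x, t))) =
  (fun h => h^-1 *: (((fun s => K (x, s)) \o shift t) (h *: 1) - K (x, t))).
  apply/funext => h; congr (_ *: (_ - _)); rewrite /=; congr K; congr pair.
  by rewrite /= scaler0 add0r.
by [].
Qed.

Lemma derive_periodic g p : (forall t, g (t + p) = g t) -> 'D_1 g p = 'D_1 g 0.
Proof.
move=> gp; rewrite /derive.
have -> : (fun h => h^-1 *: ((g \o shift p) (h *: 1) - g p)) =
  (fun h => h^-1 *: ((g \o shift 0) (h *: 1) - g 0)) => //.
apply/funext => h; rewrite /= gp addr0; congr (_ *: (_ - _)).
by have := gp 0; rewrite add0r.
Qed.

(** Fundamental theorem of calculus along a curve in the fibre on which K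
    takes the same value at both ends. *)
Lemma integral_loop_derivative K x (b : R) : 0 < b ->
  (forall t, differentiable K (x, t)) ->
  continuous (fun t => 'D_dt K (x, t)) -> K (x, b) = K (x, 0) ->
  \int[@lebesgue_measure R]_(t in `[0, b]) 'D_dt K (x, t) = 0.
Proof.
move=> b0 dK cK pK.
have d t : derivable (fun s => K (x, s)) t 1.
  by have [_ /iffRL] := derive_fiber K x t; apply; exact/diff_derivable/dK.
have c t : {for t, continuous (fun s => K (x, s))}.
  exact/differentiable_continuous/derivable1_diffP/d.
have cw := @continuous_subspaceT _ _ `[0, b] _ cK.
have FTC := @continuous_FTC2 R (fun t => 'D_dt K (x, t)) (fun s => K (x, s)) 0 b b0 cw.
rewrite /Rintegral FTC.
- by rewrite -EFinB /= pK subrr.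
- split=> [t _||]; first exact: d.
  + exact/cvg_at_right_filter/c.
  + exact/cvg_at_left_filter/c.
- by move=> t _; rewrite derive1E; have [-> _] := derive_fiber K x t.
Qed.

(** Used for the orientation of the fibres: they are connected and the contact
    volume does not vanish. *)
Lemma sg_constant g s t : continuous g -> (forall t, g t != 0) ->
  Num.sg (g s) = Num.sg (g t).
Proof.
move=> cg g0; wlog st : s t / s <= t.
  by move=> H; have [/H//|/ltW /H/esym] := leP s t.
have noroot : ~ (exists2 c, c \in `[s, t] & g c = 0).
  by move=> [c _ gc]; have := g0 c; rewrite gc eqxx.
have ivt := @IVT R g s t 0 st (continuous_subspaceT cg).
have [gs|gs|/eqP] := ltgtP (g s) 0; last by rewrite (negbTE (g0 s)).
  have [gt|gt|/eqP] := ltgtP (g t) 0; last by rewrite (negbTE (g0 t)).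
    by rewrite !ltr0_sg.
  by case: noroot; apply: ivt; rewrite ge_min le_max (ltW gs) (ltW gt) orbT.
have [gt|gt|/eqP] := ltgtP (g t) 0; last by rewrite (negbTE (g0 t)).
  by case: noroot; apply: ivt; rewrite ge_min le_max (ltW gs) (ltW gt) orbT.
by rewrite !gtr0_sg.
Qed.

End fiber_calculus.

Section laplacian.
Context (R : realType) (T : topologicalType) (S : atlas T 'rV[R]_2).
Notation V2 := 'rV[R]_2.
Notation E3 := (V2 * R)%type.
Notation e0 := (ej R ord0).
Notation e1 := (ej R ord_max).
Notation dx0 := (d_x R ord0).
Notation dx1 := (d_x R ord_max).
Notation dt := (d_theta R).
Context (oS : forall i, open (dom S i)).
Context (F : tangent S -> R) (sF : smooth_norm F).
Context (i : idx S) (hv0 : forall y, tube i y -> contact_density F i y != 0).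
Local Notation a0 := (hilbert_coef F i ord0).
Local Notation a1 := (hilbert_coef F i ord_max).
Let oT : open (tube i) := open_tube oS (i := i).

Lemma hilbert_coef_periodic j x t :
  hilbert_coef F i j (x, t + 2 * pi) = hilbert_coef F i j (x, t).
Proof. by rewrite /hilbert_coef /hilbert_form /= !dirE mulr_natl cosD2pi sinD2pi. Qed.

Lemma hilbert_coef_periodic0 j x :
  hilbert_coef F i j (x, 2 * pi) = hilbert_coef F i j (x, 0).
Proof. by have := hilbert_coef_periodic j x 0; rewrite add0r. Qed.

Lemma derive_hilbert_coef_periodic j x :
  'D_dt (hilbert_coef F i j) (x, 2 * pi) = 'D_dt (hilbert_coef F i j) (x, 0).
Proof.
apply: (etrans (esym (derive_fiber _ x _).1)).
apply: (etrans _ (derive_fiber _ x _).1).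
by apply: derive_periodic => t; exact: hilbert_coef_periodic.
Qed.

Section on_functions.
Context (u : T -> R) (Cu : Ck_fun S 2 u).
Local Notation W := (reeb_base a0 a1 (u \o par S i)).

Lemma eq_reeb_base (b0 b1 : E3 -> R) (v : V2 -> R) x s t :
  b0 (x, s) = b0 (x, t) -> b1 (x, s) = b1 (x, t) ->
  'D_dt b0 (x, s) = 'D_dt b0 (x, t) -> 'D_dt b1 (x, s) = 'D_dt b1 (x, t) ->
  reeb_base b0 b1 v (x, s) = reeb_base b0 b1 v (x, t).
Proof. by rewrite /reeb_base /reeb0 /reeb1 /vol_coef => -> -> -> ->. Qed.

Lemma reeb_base_periodic (v : V2 -> R) x :
  reeb_base a0 a1 v (x, 2 * pi) = reeb_base a0 a1 v (x, 0).
Proof.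
apply: eq_reeb_base; first exact: hilbert_coef_periodic0.
- exact: hilbert_coef_periodic0.
- exact: derive_hilbert_coef_periodic.
- exact: derive_hilbert_coef_periodic.
Qed.

Lemma Ck_derive_hilbert_coef k v j : Ck k (tube i) ('D_v (hilbert_coef F i j)).
Proof. exact/Ck_derive/Ck_hilbert_coef. Qed.

Lemma Ck_quot k (g : E3 -> R) : Ck k (tube i) g ->
  Ck k (tube i) (fun y => g y / contact_density F i y).
Proof.
by move=> Cg; apply: (CkM oT Cg); apply: (CkV oT) => //; exact: Ck_contact_density.
Qed.

Lemma Ck_reeb_base : Ck 1 (tube i) W.
Proof.
have CU v : Ck 1 (tube i) (fun y : E3 => 'D_v (u \o par S i) y.1).
  exact: (Ck_fst (@oS i) (Ck_derive v (Cu i))).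
apply: (CkD oT); apply: (CkM oT) => //; apply: Ck_quot;
  last exact: Ck_derive_hilbert_coef.
exact/(CkN oT)/Ck_derive_hilbert_coef.
Qed.

Lemma diff_reeb_base y : tube i y -> differentiable W y.
Proof. exact: Ck_differentiable Ck_reeb_base y. Qed.

Lemma diff_u y : tube i y -> differentiable (u \o par S i) y.1.
Proof. exact: (Ck_differentiable (Cu i)). Qed.

Lemma Ck_reeb_square : Ck 0 (tube i) (fun y => 'D_(reeb_vector a0 a1 y) W y).
Proof.
have DW v : Ck 0 (tube i) ('D_v W) by exact/Ck_derive/Ck_reeb_base.
have C0 : Ck 0 (tube i) (reeb0 a0 a1).
  exact/Ck_quot/(CkN oT)/Ck_derive_hilbert_coef.
have C1 : Ck 0 (tube i) (reeb1 a0 a1) by exact/Ck_quot/Ck_derive_hilbert_coef.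
have Ct : Ck 0 (tube i) (reebt a0 a1).
  apply: Ck_quot; apply: (CkD oT); first exact: Ck_derive_hilbert_coef.
  exact/(CkN oT)/Ck_derive_hilbert_coef.
have := CkD oT (CkD oT (CkM oT C0 (DW dx0)) (CkM oT C1 (DW dx1))) (CkM oT Ct (DW dt)).
apply: eq_Ck => // y; rewrite inE => Dy.
rewrite (derive_frame (reeb_vector a0 a1 y) (diff_reeb_base Dy)).
by have [-> -> ->] := frame_coords (reeb0 a0 a1 y) (reeb1 a0 a1 y) (reebt a0 a1 y).
Qed.

Local Notation pull := (fun y : E3 => u (par S i y.1)).

Lemma lie_reebE y : tube i y -> lie_reeb F i pull y = W y.
Proof.
move=> Dy; rewrite /lie_reeb (reebE oS sF Dy (hv0 Dy)).
exact: derive_reeb_base (diff_u Dy).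
Qed.

Lemma lie_reeb_squareE y : tube i y ->
  lie_reeb F i (lie_reeb F i pull) y = 'D_(reeb_vector a0 a1 y) W y.
Proof.
move=> Dy; rewrite {1}/lie_reeb (reebE oS sF Dy (hv0 Dy)).
by apply: (eq_derive_open _ oT) => // z; rewrite inE => Dz; exact: lie_reebE.
Qed.

Context (f : T -> R) (sf : smooth_fun S f).
Local Notation fp := (f \o par S i).

Lemma lie_reeb_conformal y : tube i y ->
  lie_reeb (conformal f F) i pull y = (expR (fp y.1))^-1 * W y.
Proof.
move=> Dy; rewrite /lie_reeb (reeb_conformalE oS sF sf Dy (hv0 Dy)).
rewrite (derive_reeb_base _ _ (diff_u Dy)) reeb_base_scaled//.
- exact: (diff_f sf Dy).
- exact: diff_hilbert_coef.
- exact: diff_hilbert_coef.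
- exact: hv0.
Qed.

(** Multiplying by the contact density turns the discrepancy between the two second
    derivatives into an exact derivative along the fibre. *)
Lemma lie_reeb_square_conformal y : tube i y ->
  expR (fp y.1) ^+ 2 * contact_density F i y *
    lie_reeb (conformal f F) i (lie_reeb (conformal f F) i pull) y =
  contact_density F i y * lie_reeb F i (lie_reeb F i pull) y +
  'D_dt (W * ('D_e0 fp y.1 *: a1 - 'D_e1 fp y.1 *: a0)) y.
Proof.
move=> Dy; rewrite (lie_reeb_squareE Dy) {1}/lie_reeb.
rewrite (reeb_conformalE oS sF sf Dy (hv0 Dy)).
have d0 := diff_hilbert_coef oS sF ord0 Dy.
have d1 := diff_hilbert_coef oS sF ord_max Dy.
have df := diff_f sf Dy.
rewrite (derive_dt_primitive erefl erefl d0 d1 (diff_reeb_base Dy) (hv0 Dy)).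
rewrite -(derive_reeb_rescaled df d0 d1 (hv0 Dy) (diff_reeb_base Dy)).
congr (_ * _); apply: (eq_derive_open _ oT) => // z; rewrite inE => Dz.
exact: lie_reeb_conformal.
Qed.

End on_functions.
End laplacian.

(** * Conformal change of the Laplacian *)

Section final.
Context (R : realType).
Notation V2 := 'rV[R]_2.
Notation E3 := (V2 * R)%type.
Notation e0 := (ej R ord0).
Notation e1 := (ej R ord_max).
Notation dt := (d_theta R).

Lemma integral_mod_loop (g : R -> R) (K : E3 -> R) x (b c k : R) : 0 < b ->
  continuous g -> (forall t, differentiable K (x, t)) ->
  continuous (fun t => 'D_dt K (x, t)) -> K (x, b) = K (x, 0) ->
  \int[@lebesgue_measure R]_(t in `[0, b]) (c * (g t + k * 'D_dt K (x, t))) =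
  c * \int[@lebesgue_measure R]_(t in `[0, b]) g t.
Proof.
move=> b0 cg dK cK pK.
have int (h : R -> R) : continuous h ->
    (@lebesgue_measure R).-integrable `[0, b] (EFin \o h).
  move=> ch; apply: continuous_compact_integrable; first exact: segment_compact.
  exact: continuous_subspaceT.
have ckK : continuous (fun t => k * 'D_dt K (x, t)).
  by move=> t; apply: cvgM; [exact: cvg_cst|exact: cK].
rewrite RintegralZl//; last first.
  apply: (int (fun t => g t + k * 'D_dt K (x, t))) => t.
  by apply: cvgD; [exact: cg|exact: ckK].
rewrite RintegralD//; [|exact: int..].
rewrite RintegralZl//; last exact: (int (fun t => 'D_dt K (x, t))).
by rewrite (integral_loop_derivative b0 dK cK pK) mulr0 addr0.
Qed.

Section surface.
Context (T : topologicalType) (S : atlas T 'rV[R]_2).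
Context (oS : forall i, open (dom S i)).
Context (F : tangent S -> R) (sF : smooth_norm F).
Context (f : T -> R) (sf : smooth_fun S f).

(** The angle form is the contact density divided by a constant of the fibre, so
    the discrepancy of [lie_reeb_square_conformal] integrates to 0. *)
Lemma fiber_integral_conformal (Om : tangent S -> tangent S -> R)
    (a a' : tangent (HM S) -> R) (u : T -> R) (i : idx S) (x : V2) :
  finsler_volume_angle F Om a -> Ck_fun S 2 u -> dom S i x ->
  (forall t, a' (HMvec i (x, t) dt) = a (HMvec i (x, t) dt)) ->
  let pull (y : E3) := u (par S i y.1) in
  fiber_integral (conformal f F) a' i x
    (lie_reeb (conformal f F) i (lie_reeb (conformal f F) i pull)) =
  expR (f (par S i x)) ^- 2 *
  fiber_integral F a i x (lie_reeb F i (lie_reeb F i pull)).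
Proof.
move=> fa Cu Dx aa' pull.
have oT := open_tube oS (i := i).
have hv0 y : tube i y -> contact_density F i y != 0.
  by move=> Dy; have [_ _ ->] := angle_coef oS sF fa Dy.
have Dt t : tube i (x, t) by [].
pose om := Om (tvec i x e0) (tvec i x e1).
have aE t : a (HMvec i (x, t) dt) = contact_density F i (x, t) / om.
  by have [om0 <- _] := angle_coef oS sF fa (Dt t); rewrite mulfK.
have sgE t : Num.sg (contact_density F i (x, t)) = Num.sg (contact_density F i (x, 0)).
  apply: (sg_constant (g := fun t => contact_density F i (x, t))) => [|s];
    last exact: hv0.
  exact: (continuous_fiber Dx (Ck_contact_density oS 0 i sF)).
pose s := Num.sg (contact_density F i (x, 0)).
pose L := lie_reeb F i (lie_reeb F i pull).
pose fp := f \o par S i.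
(* The primitive along the fibre; the derivatives of f are frozen at x. *)
pose K := reeb_base (hilbert_coef F i ord0) (hilbert_coef F i ord_max) (u \o par S i) *
  ('D_e0 fp x *: hilbert_coef F i ord_max - 'D_e1 fp x *: hilbert_coef F i ord0).
pose g t := s * (L (x, t) * (contact_density F i (x, t) / om)).
have CK : Ck 1 (tube i) K.
  have CH j := Ck_hilbert_coef oS sF 1 i j.
  have CC (c : R) j : Ck 1 (tube i) (c *: hilbert_coef F i j) :=
    CkM oT (Ck_cst 1 _ c) (CH j).
  apply: (CkM oT); first exact: Ck_reeb_base.
  by apply: (CkD oT); last apply: (CkN oT).
transitivity (\int[@lebesgue_measure R]_(t in `[0, 2 * pi])
    (expR (f (par S i x)) ^- 2 * (g t + (s / om) * 'D_dt K (x, t)))).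
  apply: eq_Rintegral => t _; rewrite aa' aE /fiber_sign.
  rewrite (contact_volume_conformal oS sF sf _ _ _ (Dt t)).
  rewrite (contact_volume_frame oS sF (Dt t)) sgrM gtr0_sg ?mul1r; last first.
    by rewrite exprn_gt0// expR_gt0.
  rewrite sgE -/s /g.
  have := lie_reeb_square_conformal oS sF hv0 Cu sf (Dt t); rewrite -/fp -/pull -/L.
  have ee : expR (f (par S i x)) != 0 by rewrite expR_eq0.
  have drop (e h q l d o z : R) : e != 0 -> e ^+ 2 * h * q = h * l + d ->
      z * (q * (h / o)) = e ^- 2 * (z * (l * (h / o)) + z / o * d).
    move=> en E; have -> : d = e ^+ 2 * h * q - h * l by rewrite E addrC addKr.
    transitivity (e ^- 2 * e ^+ 2 * (z * q * h / o)); last by ring.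
    by rewrite mulVf ?expf_neq0// mul1r; ring.
  by move=> E; exact: drop ee E.
rewrite integral_mod_loop.
- congr (_ * _); apply: eq_Rintegral => t _.
  by rewrite /g aE /fiber_sign (contact_volume_frame oS sF (Dt t)) sgE.
- by rewrite mulr_gt0// pi_gt0.
- move=> t; apply: cvgM; first exact: cvg_cst.
  apply: cvgM.
    apply: (continuous_fiber Dx); have := Ck_reeb_square oS sF hv0 Cu.
    by apply: eq_Ck => // y; rewrite inE => Dy; rewrite /L lie_reeb_squareE.
  apply: cvgM; last exact: cvg_cst.
  exact: (continuous_fiber Dx (Ck_contact_density oS 0 i sF)).
- by move=> t; exact: (Ck_differentiable CK).
- exact: (continuous_fiber Dx (Ck_derive dt CK)).
- have per (p q r p' q' r' c d : R) : p = p' -> q = q' -> r = r' ->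
    p * (c * q - d * r) = p' * (c * q' - d * r') by move=> -> -> ->.
  apply: per; first exact: reeb_base_periodic.
    exact: hilbert_coef_periodic0.
  exact: hilbert_coef_periodic0.
Qed.

Lemma fiber_integral0 (G : tangent S -> R) i x w : fiber_integral G (fun=> 0) i x w = 0.
Proof.
rewrite /fiber_integral; under eq_Rintegral do rewrite !mulr0.
by rewrite Rintegral_cst// mul0r.
Qed.

Lemma volume_angle_exists (G : tangent S -> R) Om a :
  finsler_volume_angle G Om a ->
  finsler_volume_angle G (finsler_volume G) (angle_form G).
Proof.
move=> fa.
exact: (@getPex _ [set Oa | finsler_volume_angle G Oa.1 Oa.2] (ex_intro _ (Om, a) fa)).
Qed.

Lemma finsler_laplacian_in_conformal (u : T -> R) i x : Ck_fun S 2 u -> dom S i x ->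
  finsler_laplacian_in (conformal f F) u i x =
  expR (f (par S i x)) ^- 2 * finsler_laplacian_in F u i x.
Proof.
move=> Cu Dx; rewrite /finsler_laplacian_in mulrCA; congr (_ * _).
have [[[Om a] /= fa]|none] := pselect (exists Oa :
  (tangent S -> tangent S -> R) * (tangent (HM S) -> R),
  finsler_volume_angle F Oa.1 Oa.2).
  have fa' := volume_angle_conformal oS sF sf fa.
  have getF : finsler_volume_angle F (finsler_volume F) (angle_form F).
    exact: (volume_angle_exists fa).
  have getFf : finsler_volume_angle (conformal f F)
      (finsler_volume (conformal f F)) (angle_form (conformal f F)).
    exact: (volume_angle_exists fa').
  apply: (fiber_integral_conformal getF Cu Dx) => t.
  (* Transported back to F, the angle form chosen for e^f F is compared with the
     one chosen for F. *)
  have back := volume_angle_conformalV oS sF sf getFf.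
  exact: (angle_unique oS sF back getF (y := (x, t)) Dx).
have noneF : angle_form F = fun=> 0.
  rewrite /angle_form /volume_angle getPN ?point_angle// => Oa fOa.
  by apply: none; exists Oa.
have nonef : angle_form (conformal f F) = fun=> 0.
  rewrite /angle_form /volume_angle getPN ?point_angle// => Oa fOa.
  apply: none; eexists (_, Oa.2).
  exact: (volume_angle_conformalV oS sF sf fOa).
by rewrite noneF nonef !fiber_integral0 mulr0.
Qed.
End surface.
End final.

Theorem theorem4p9 (R : realType) (T : topologicalType)
    (S : atlas T 'rV[R]_2) (F : tangent S -> R) (f : T -> R) :
  oriented_surface S -> finsler F -> smooth_fun S f ->
  forall u : T -> R, Ck_fun S 2 u ->
  forall p : T,
    finsler_laplacian (conformal f F) u p
    = expR (- (2 * f p)) * finsler_laplacian F u p.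
Proof.
move=> [_ _ cov charts _] fin sf u Cu p.
have oS i : open (dom S i) by have [] := charts i.
have sF : smooth_norm F by move=> i; have [_ + _ _ _] := fin i.
have [Dp parp] : dom S (coords_at S p).1 (coords_at S p).2 /\
    par S (coords_at S p).1 (coords_at S p).2 = p.
  have [i [x ix]] := cov p.
  exact: (@getPex _ [set c | dom S c.1 c.2 /\ par S c.1 c.2 = p]
    (ex_intro _ (i, x) ix)).
rewrite /finsler_laplacian (finsler_laplacian_in_conformal oS sF sf Cu Dp) parp.
by rewrite expRN expRM_natl.
Qed.
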